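(* Let $m\in\mathbb{N}$ and, for $i=1,\dots,m$, let $f_i,g_i:[0,\infty)^m\to[0,\infty)$ be locally Lipschitz continuous functions and let $a_i\ge 0$. Then the initial value problem \[ u_i'(t)=-f_i(\boldsymbol{u}(t))\,u_i(t)+g_i(\boldsymbol{u}(t)),\quad t>0,\qquad u_i(0)=a_i,\qquad i=1,\dots,m, \] for the unknown $\boldsymbol{u}=(u_1,\dots,u_m)$ admits a time-local unique non-negative solution: there exist $T>0$ and a unique $\boldsymbol{u}\in C^1([0,T];\mathbb{R}^m)$ with $u_i(t)\ge 0$ for all $t\in[0,T]$ and all $i=1,\dots,m$ that satisfies $\boldsymbol{u}(0)=(a_1,\dots,a_m)$ and the differential equations on $(0,T]$.
   Context: Here ${}'=d/dt$; at $t=T$ the derivative is the one-sided derivative. ''Time-local'' means that the solution exists on some interval $[0,T]$ with $T>0$ depending on the data. *)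

(* Defs.v *)
From HB Require Import structures.
From mathcomp Require Import all_boot all_order all_algebra.
From mathcomp Require Import all_classical all_reals all_analysis.

Set Implicit Arguments.
Unset Strict Implicit.
Unset Printing Implicit Defensive.

Import Order.TTheory GRing.Theory Num.Theory.
Import numFieldNormedType.Exports.

Local Open Scope classical_set_scope.
Local Open Scope ring_scope.

Definition orthant (R : realType) (m : nat) : set 'rV[R]_m :=
  [set x | forall i, 0 <= x ord0 i].

(* Derivative relative to A: two-sided at interior points of A, one-sided at
   the end points when A is a segment. Only the values of u on A matter. *)
Definition has_derivative_in (R : realType) (V : normedModType R)
    (A : set R) (u : R -> V) (t : R) (l : V) : Prop :=
  (s - t)^-1 *: (u s - u t) @[s --> within A t^'] --> l.

Definition C1_on_segment (R : realType) (V : normedModType R)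
    (a b : R) (u : R -> V) : Prop :=
  exists2 du : R -> V,
    {within `[a, b], continuous du} &
    forall t, t \in `[a, b] -> has_derivative_in `[a, b]%classic u t (du t).

(* f and g are total functions, but the sign condition ensures that only their
   values on the orthant are used. *)
Definition nonneg_solution (R : realType) (m : nat)
    (f g : 'I_m -> 'rV[R]_m -> R) (a : 'rV[R]_m)
    (T : R) (u : R -> 'rV[R]_m) : Prop :=
  [/\ C1_on_segment 0 T u,
      forall t, t \in `[0, T] -> forall i, 0 <= u t ord0 i,
      u 0 = a &
      forall t, t \in `]0, T] -> forall i,
        has_derivative_in `[0, T]%classic (fun s => u s ord0 i) t
          (- f i (u t) * u t ord0 i + g i (u t))].

(* Main.v *)
(* Composing the vector field with the coordinatewise projection onto a small
   box around a inside the orthant makes it bounded and globally Lipschitz, so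
   Picard iteration yields a solution u on a short segment, which moves too
   slowly to leave the ball around a. Where u_i < 0 its projection is 0, so
   u_i' = g_i >= 0, which is incompatible with u_i having crossed 0 downwards;
   hence u >= 0, the projection is inactive and u solves the original system.
   Conversely the mean value theorem keeps every nonnegative solution in the
   ball, so it is a fixed point of the same contraction. *)
Require Import Defs.
From HB Require Import structures.
From mathcomp Require Import all_boot all_order all_algebra.
From mathcomp Require Import all_classical all_reals all_analysis.
From mathcomp Require Import ring lra.

Set Implicit Arguments.
Unset Strict Implicit.
Unset Printing Implicit Defensive.

Import Order.TTheory GRing.Theory Num.Theory.
Import numFieldNormedType.Exports.

Local Open Scope classical_set_scope.
Local Open Scope ring_scope.

(** * Coordinates of row vectors and derivatives relative to a set *)

Lemma row_norm_le (R : realType) (m : nat) (x : 'rV[R]_m) (c : R) :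
  0 <= c -> (`|x| <= c) <-> (forall i, `|x ord0 i| <= c).
Proof.
move=> c0; rewrite [`|x|]mx_normrE; split => [/bigmax_leP[_ h] i|h].
  exact: (h (ord0, i)).
by apply/bigmax_leP; split => // -[i j] _; rewrite (ord1 i).
Qed.

Lemma row_coord_le (R : realType) (m : nat) (x : 'rV[R]_m) (i : 'I_m) :
  `|x ord0 i| <= `|x|.
Proof. exact: (row_norm_le x (normr_ge0 _)).1. Qed.

(** Multiplying the difference quotient by [s - t] removes the division; at [s = t] both sides
    vanish, so the punctured neighbourhood becomes a full one. *)
Lemma has_derivative_inP (R : realType) (V : normedModType R) (A : set R)
    (u : R -> V) (t : R) (l : V) :
  has_derivative_in A u t l <->
  forall e, 0 < e -> \forall s \near within A (nbhs t),
    `|u s - u t - (s - t) *: l| <= e * `|s - t|.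
Proof.
have key s : s != t -> u s - u t - (s - t) *: l =
    (s - t) *: ((s - t)^-1 *: (u s - u t) - l).
  by move=> st; rewrite scalerBr scalerA mulfV ?subr_eq0// scale1r.
split => [/cvgrPdist_le h e e0|h].
  move: (h e e0); rewrite !near_withinE; apply: filterS => s hs As.
  have [->|st] := eqVneq s t; first by rewrite !subrr scale0r subr0 !normr0 mulr0.
  by rewrite key// normrZ mulrC ler_wpM2r// distrC; exact: hs.
apply/cvgrPdist_le => e e0.
move: (h e e0); rewrite !near_withinE; apply: filterS => s hs st As.
have st0 : 0 < `|s - t| by rewrite normr_gt0 subr_eq0.
by rewrite distrC -(ler_pM2r st0) mulrC -normrZ -key//; exact: hs.
Qed.

Lemma has_derivative_in_row (R : realType) (m : nat) (A : set R)
    (u : R -> 'rV[R]_m) (t : R) (l : 'rV[R]_m) :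
  has_derivative_in A u t l <->
  forall i, has_derivative_in A (fun s => u s ord0 i) t (l ord0 i).
Proof.
have coord s i : (u s - u t - (s - t) *: l) ord0 i =
    u s ord0 i - u t ord0 i - (s - t) *: l ord0 i by rewrite !mxE.
split => [/has_derivative_inP h i|h]; apply/has_derivative_inP => e e0.
  apply: filterS (h e e0) => s; rewrite -coord; exact/le_trans/row_coord_le.
have : \forall s \near within A (nbhs t), forall i : 'I_m,
    `|u s ord0 i - u t ord0 i - (s - t) *: l ord0 i| <= e * `|s - t|.
  by apply: filter_forall => i; exact: (has_derivative_inP _ _ _ _).1 (h i) _ e0.
apply: filterS => s hs; apply/row_norm_le => [|i].
  by rewrite mulr_ge0// ltW.
by rewrite coord; exact: hs.
Qed.

(** The first-order expansion with error factor 1 bounds the increment by [(1 + |du t|) |s - t|]. *)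
Lemma has_derivative_in_within_continuous (R : realType) (V : normedModType R)
    (A : set R) (u du : R -> V) :
  (forall t, A t -> has_derivative_in A u t (du t)) ->
  {within A, continuous u}.
Proof.
move=> hu; apply/subspace_continuousP => t At.
have /has_derivative_inP/(_ 1 ltr01) hd := hu t At.
apply/cvgrPdist_le => e e0.
have k0 : 0 < 1 + `|du t| by rewrite ltr_pwDl.
have hb : \forall s \near within A (nbhs t), `|s - t| < e / (1 + `|du t|).
  apply: cvg_within; apply/nbhs_ballP; exists (e / (1 + `|du t|)) => /=.
    by rewrite divr_gt0.
  by move=> s; rewrite /ball/= distrC.
apply: filterS2 hd hb => s; rewrite mul1r => hs se.
rewrite distrC -[u s - u t](subrK ((s - t) *: du t)).
apply: (le_trans (ler_normD _ _)).
apply: (@le_trans _ _ (`|s - t| * (1 + `|du t|))).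
  by rewrite mulrDr mulr1 normrZ lerD2r.
by rewrite -ler_pdivlMr// ltW.
Qed.

(** At an interior point a neighbourhood relative to the segment is a full one. This gives access to
    the mean value theorem for [is_derive]. *)
Lemma has_derivative_in_is_derive (R : realType) (a b : R) (u : R -> R)
    (t l : R) :
  t \in `]a, b[ -> has_derivative_in `[a, b] u t l -> is_derive t 1 u l.
Proof.
move=> tab /has_derivative_inP h.
have abt : nbhs t `[a, b]%classic.
  have : nbhs t `]a, b[%classic by apply: open_nbhs_nbhs; split.
  by apply: filterS; exact: subset_itv_oo_cc.
have cv : h^-1 *: (u (h *: 1 + t) - u t) @[h --> 0^'] --> l.
  apply/cvgrPdist_le => e e0; have := h e e0; rewrite near_withinE => {}h.
  have /nbhs_ballP[d /= d0 hd] : \forall s \near t,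
      `|u s - u t - (s - t) *: l| <= e * `|s - t|.
    by apply: filterS2 abt h => s As; exact.
  apply/nbhs_ballP; exists d => //= k; rewrite /ball/= sub0r normrN => kd k0.
  have := hd (k + t); rewrite /ball/= opprD addrCA subrr addr0 normrN addrK.
  move=> /(_ kd) H.
  have k1 : 0 < `|k| by rewrite normr_gt0.
  rewrite distrC -(ler_pM2r k1); apply: le_trans H.
  rewrite -normrM mulrBl /GRing.scale/= mulr1 mulrAC mulVf// mul1r.
  by rewrite (mulrC l).
by split; [exact: cvgP cv|exact/cvg_lim].
Qed.

(** Serves paths frozen outside the segment: at an end point they inherit a one-sided derivative
    from a function differentiable across it. *)
Lemma is_derive_has_derivative_in (R : realType) (A : set R) (u F : R -> R)
    (t l : R) : A t -> (forall s, A s -> u s = F s) ->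
  is_derive t 1 F l -> has_derivative_in A u t l.
Proof.
move=> At uF dF; apply/has_derivative_inP => e e0.
have cv : h^-1 *: (F (h *: 1 + t) - F t) @[h --> 0^'] --> l.
  by rewrite -[l]derive_val; exact: (@ex_derive _ _ _ _ _ _ _ dF).
have /cvgrPdist_le/(_ _ e0)/nbhs_ballP[d /= d0 hd] := cv.
apply/nbhs_ballP; exists d => //= s; rewrite /ball/= distrC => std As.
rewrite !uF//.
have [->|st] := eqVneq s t; first by rewrite !subrr scale0r subr0 !normr0 mulr0.
have := hd (s - t); rewrite /ball/= sub0r normrN subr_eq0 => /(_ std st).
rewrite /GRing.scale/= mulr1 subrK => H.
have -> : F s - F t - (s - t) * l = - ((l - (s - t)^-1 * (F s - F t)) * (s - t)).
  by field; rewrite subr_eq0.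
by rewrite normrN normrM ler_wpM2r.
Qed.

(** * Mean value estimates, primitives and clamping *)

Lemma segment_MVT (R : realType) (a b : R) (u du : R -> R) (s t : R) :
  {within `[a, b], continuous u} ->
  (forall x, x \in `]a, b[ -> has_derivative_in `[a, b] u x (du x)) ->
  a <= s -> s < t -> t <= b ->
  exists2 c, c \in `]s, t[ & u t - u s = du c * (t - s).
Proof.
move=> cu hu as_ st tb; apply: MVT => // [x xst|].
  have xab : x \in `]a, b[.
    by move: xst; rewrite !in_itv/= => /andP[? ?]; apply/andP; split; lra.
  exact: has_derivative_in_is_derive (hu x xab).
apply: continuous_subspaceW cu => x /=; rewrite !in_itv/= => /andP[? ?].
by apply/andP; split; lra.
Qed.

Lemma continuous_primitive (R : realType) (h : R -> R) : continuous h ->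
  exists2 F : R -> R, F 0 = 0 & forall t : R, 0 <= t -> is_derive t 1 F (h t).
Proof.
move=> ch.
(* The base point -1 makes the derivative at 0 two-sided. *)
pose G x := (\int[lebesgue_measure]_(t in `[(-1)%R, x]) h t)%R.
have dG (t : R) : 0 <= t -> is_derive t 1 G (h t).
  move=> t0; have ih : lebesgue_measure.-integrable `[-1, t + 1] (EFin \o h).
    apply: continuous_compact_integrable; first exact: segment_compact.
    exact: continuous_subspaceT.
  have tt1 : t < t + 1 by rewrite ltrDl.
  have t1 : -1 < t by rewrite (lt_le_trans _ t0)// ltrN10.
  have [d1 d2] := continuous_FTC1_closed tt1 ih t1 (ch t).
  by split => //; rewrite -derive1E.
exists (fun x => G x - G 0) => [|t t0]; first by rewrite subrr.
by have dGt := dG t t0; rewrite -[h t]subr0; exact: is_deriveB.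
Qed.

(** For [a <= b], the nearest-point retraction onto [[a, b]]; it serves both to freeze time outside
    [[0, T]] and to project coordinates onto a box. *)
Definition clamp (R : realType) (a b x : R) : R := Num.max a (Num.min x b).

Lemma clamp_itv (R : realType) (a b x : R) : a <= b -> clamp a b x \in `[a, b].
Proof. by move=> ab; rewrite in_itv/= /clamp le_max lexx ge_max ab ge_min lexx orbT. Qed.

Lemma clamp_id (R : realType) (a b x : R) : x \in `[a, b] -> clamp a b x = x.
Proof.
by rewrite in_itv/= => /andP[ax xb]; rewrite /clamp min_l // max_r.
Qed.

Lemma clamp_dist (R : realType) (a b x y : R) :
  `|clamp a b x - clamp a b y| <= `|x - y|.
Proof.
rewrite /clamp; case: (leP x b) => ?; case: (leP y b) => ?;
  case: (leP a x) => ?; case: (leP a y) => ?; case: (leP a b) => ?;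
  rewrite ler_norml;
  have := ler_norm (x - y); have := ler_norm (- (x - y)); rewrite normrN;
  move=> ? ?; apply/andP; split; lra.
Qed.

Lemma segment_lipschitz (R : realType) (a b c : R) (u du : R -> R) :
  {within `[a, b], continuous u} ->
  (forall x, x \in `]a, b[ -> has_derivative_in `[a, b] u x (du x)) ->
  (forall x, x \in `]a, b[ -> `|du x| <= c) ->
  forall s t, s \in `[a, b] -> t \in `[a, b] -> `|u t - u s| <= c * `|t - s|.
Proof.
move=> cu hu hc s t; wlog st : s t / s <= t => [hw sab tab|].
  case/orP: (le_total s t) => st; first exact: hw.
  by rewrite distrC (distrC t); exact: hw.
move: st; rewrite le_eqVlt => /predU1P[->|st]; first by rewrite !subrr !normr0 mulr0.
rewrite !in_itv/= => /andP[as_ _] /andP[_ tb].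
have [x xst ->] := segment_MVT cu hu as_ st tb.
rewrite normrM ler_wpM2r// hc//.
by move: xst; rewrite !in_itv/= => /andP[? ?]; apply/andP; split; lra.
Qed.

(** * Geometric convergence *)

Lemma geometric_increments_cvg (R : realType) (x : nat -> R) (C : R) :
  (forall n, `|x n.+1 - x n| <= C / 2 ^+ n) ->
  exists l, forall n, `|x n - l| <= 2 * C / 2 ^+ n.
Proof.
move=> hx.
have C0 : 0 <= C by have := le_trans (normr_ge0 _) (hx 0%N); rewrite expr0 divr1.
(* Keeping the subtracted term makes the induction close: it drops by exactly [C / 2 ^+ (n + k)] at
   each step, the size of the next increment. *)
have xk n k : `|x n - x (n + k)%N| <= 2 * C / 2 ^+ n - 2 * C / 2 ^+ (n + k).
  elim: k => [|k IH]; first by rewrite addn0 !subrr normr0.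
  rewrite addnS -[x n](subrK (x (n + k)%N)) -addrA.
  apply: (le_trans (ler_normD _ _)).
  rewrite (distrC (x (n + k)%N)); apply: (le_trans (lerD IH (hx (n + k)%N))).
  by rewrite exprS invfM; lra.
have xk' n k : `|x n - x (n + k)%N| <= 2 * C / 2 ^+ n.
  by apply: (le_trans (xk n k)); rewrite gerBl divr_ge0// ?mulr_ge0// exprn_ge0.
have cx : cvgn x.
  apply/cauchy_cvgP/cauchy_exP => e e0.
  have [n hn] : exists n, 2 * C / 2 ^+ n < e.
    have : geometric (2 * C) (2^-1 : R) n @[n --> \oo] --> (0 : R).
      by apply: cvg_geometric; rewrite ger0_norm ?invr_ge0// invf_lt1// ltr1n.
    move=> /cvgrPdist_lt/(_ _ e0)[n _ /(_ n (leqnn n))] /=.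
    rewrite sub0r normrN exprVn ger0_norm; last first.
      by rewrite divr_ge0// ?mulr_ge0// exprn_ge0.
    by exists n.
  exists (x n); exists n => // k /= nk; rewrite -(subnKC nk).
  exact: le_lt_trans (xk' _ _) hn.
exists (limn x) => n.
have cd : `|x n - x k| @[k --> \oo] --> `|x n - limn x|.
  by apply: cvg_norm; apply: cvgB => //; exact: cvg_cst.
rewrite -(cvg_lim _ cd)//; apply: limr_le; first exact: cvgP cd.
exists n => // k /= nk; rewrite -(subnKC nk); exact: xk'.
Qed.

Lemma has_derivative_inB (R : realType) (V : normedModType R) (A : set R)
    (u v : R -> V) (t : R) (k l : V) :
  has_derivative_in A u t k -> has_derivative_in A v t l ->
  has_derivative_in A (fun s => u s - v s) t (k - l).
Proof.
move=> hu hv; rewrite /has_derivative_in.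
have -> : (fun s => (s - t)^-1 *: (u s - v s - (u t - v t))) =
    (fun s => (s - t)^-1 *: (u s - u t) - (s - t)^-1 *: (v s - v t)).
  apply/funext => s; rewrite -scalerBr; congr (_ *: _).
  by rewrite [in LHS]opprD addrACA -opprD.
exact: cvgB.
Qed.

Lemma le_geometric_le0 (R : realType) (x C : R) :
  (forall n, x <= C / 2 ^+ n) -> x <= 0.
Proof.
move=> hx.
have cg : geometric C (2^-1 : R) n @[n --> \oo] --> (0 : R).
  by apply: cvg_geometric; rewrite ger0_norm ?invr_ge0// invf_lt1// ltr1n.
rewrite -(cvg_lim _ cg)//; apply: limr_ge; first exact: cvgP cg.
by apply: nearW => n /=; rewrite exprVn.
Qed.

(** The norm is the maximum of the coordinates, so the limit is taken coordinatewise with the same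
    rate. *)
Lemma row_geometric_increments_cvg (R : realType) (m : nat)
    (x : nat -> 'rV[R]_m) (C : R) :
  (forall n, `|x n.+1 - x n| <= C / 2 ^+ n) ->
  exists l, forall n, `|x n - l| <= 2 * C / 2 ^+ n.
Proof.
move=> hx.
have C0 : 0 <= C by have := le_trans (normr_ge0 _) (hx 0%N); rewrite expr0 divr1.
have /choice[l hl] (i : 'I_m) : exists l, forall n,
    `|x n ord0 i - l| <= 2 * C / 2 ^+ n.
  apply: geometric_increments_cvg => n; apply: le_trans (hx n).
  by have := row_coord_le (x n.+1 - x n) i; rewrite !mxE.
exists (\row_i l i) => n; apply/row_norm_le => [|i].
  by rewrite divr_ge0// ?mulr_ge0// exprn_ge0.
by rewrite !mxE.
Qed.

(* Encodes w t = a + \int_0^t H (u s) ds without mentioning the integral. *)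
Definition picard_image (R : realType) (m : nat) (H : 'I_m -> 'rV[R]_m -> R)
    (a : 'rV[R]_m) (T : R) (u w : R -> 'rV[R]_m) : Prop :=
  w 0 = a /\ forall i,
    {within `[0, T], continuous (fun s => w s ord0 i)} /\
    forall t, t \in `]0, T[ ->
      has_derivative_in `[0, T]%classic (fun s => w s ord0 i) t (H i (u t)).

Lemma rowB (R : realType) (m : nat) (x y : 'rV[R]_m) (i : 'I_m) :
  (x - y) ord0 i = x ord0 i - y ord0 i.
Proof. by rewrite !mxE. Qed.

(** * Picard iteration for a bounded, globally Lipschitz vector field *)

Section Picard.
Variables (R : realType) (m : nat) (H : 'I_m -> 'rV[R]_m -> R).
Variables (a : 'rV[R]_m) (T c : R).
Hypothesis T_ge0 : 0 <= T.
Hypothesis cT : c * T <= 2^-1.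
Hypothesis H_lip : forall i x y, `|H i x - H i y| <= c * `|x - y|.
Hypothesis H_bound : forall i x, `|H i x| <= c.
Hypothesis c_ge0 : 0 <= c.

Let T0 : 0 \in `[0, T].
Proof. by rewrite in_itv/= lexx. Qed.

Lemma picard_image_lipschitz u w i s t : picard_image H a T u w ->
  s \in `[0, T] -> t \in `[0, T] ->
  `|w t ord0 i - w s ord0 i| <= c * `|t - s|.
Proof.
move=> [_ /(_ i)[cw dw]] sT tT.
by apply: (segment_lipschitz cw dw) => // x _; exact: H_bound.
Qed.

(** The velocities of [w] and [w'] differ by at most [c * B], and both paths start at [a]; over a
    time of at most [T] this gives [c * T * B], hence the factor 1/2. *)
Lemma picard_image_contraction u u' w w' B :
  picard_image H a T u w -> picard_image H a T u' w' ->
  (forall t, t \in `[0, T] -> `|u t - u' t| <= B) ->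
  forall t, t \in `[0, T] -> `|w t - w' t| <= B / 2.
Proof.
move=> [w0 hw] [w'0 hw'] hB t tT.
have B0 : 0 <= B := le_trans (normr_ge0 _) (hB 0 T0).
apply/row_norm_le => [|i]; first by rewrite divr_ge0.
have [cw dw] := hw i; have [cw' dw'] := hw' i.
have := @segment_lipschitz R 0 T (c * B)
  (fun s => w s ord0 i - w' s ord0 i) (fun s => H i (u s) - H i (u' s)).
move=> /(_ _ _ _ 0 t T0 tT); rewrite w0 w'0 !subrr !subr0 !mxE => le_cBt.
apply: (@le_trans _ _ (c * B * `|t|)).
  apply: le_cBt => [|x xT|x xT].
  - exact: within_continuousB.
  - by apply: has_derivative_inB; [exact: dw|exact: dw'].
  - apply: (le_trans (H_lip _ _ _)); rewrite ler_wpM2l// hB//.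
    by move: xT; rewrite !in_itv/= => /andP[/ltW -> /ltW ->].
move: tT; rewrite in_itv/= => /andP[t0 tT]; rewrite ger0_norm//.
have : c * t <= 2^-1 by apply: le_trans cT; rewrite ler_wpM2l.
by move=> ct; rewrite mulrAC mulrC; apply: ler_wpM2l.
Qed.

(** Two fixed points are their own images, so the contraction can be repeated and the a priori bound
    [B] improves to [B / 2 ^+ n] for every [n]. *)
Lemma picard_fixpoint_unique u v B :
  picard_image H a T u u -> picard_image H a T v v ->
  (forall t, t \in `[0, T] -> `|u t - v t| <= B) ->
  forall t, t \in `[0, T] -> u t = v t.
Proof.
move=> hu hv hB t tT; apply/eqP; rewrite -subr_eq0 -normr_le0.
apply: (@le_geometric_le0 _ _ B) => n; move: t tT.
elim: n => [|n IH] t tT; first by rewrite expr0 divr1; exact: hB.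
by rewrite exprSr invfM mulrA; exact: picard_image_contraction IH _ tT.
Qed.

(** Freezing paths outside [[0, T]] keeps them Lipschitz on the whole line, so [H i (u s)] is
    continuous everywhere and has a primitive, and paths equal on the segment are equal as
    functions. *)
Let clamped_lipschitz (u : R -> 'rV[R]_m) :=
  (forall s t, `|u s - u t| <= c * `|s - t|) /\
  forall t, u t = u (clamp 0 T t).

Lemma picard_image_exists u : clamped_lipschitz u -> exists w,
  [/\ clamped_lipschitz w, picard_image H a T u w &
      forall t, t \in `[0, T] -> forall i,
        has_derivative_in `[0, T]%classic (fun s => w s ord0 i) t (H i (u t))].
Proof.
move=> [lu _].
have cH i : continuous (fun s => H i (u s)).
  move=> t; apply/cvgrPdist_le => e e0.
  (* The composite has Lipschitz constant [c * c]; the added 1 keeps the denominator positive when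
     [c = 0]. *)
  apply/nbhs_ballP; exists (e / (1 + c * c)) => /=.
    by rewrite divr_gt0// ltr_pwDl// mulr_ge0.
  move=> s; rewrite /ball/= => ts; apply: (le_trans (H_lip _ _ _)).
  apply: (@le_trans _ _ (c * (c * `|t - s|))); first by rewrite ler_wpM2l.
  have k0 : 0 < 1 + c * c by rewrite ltr_pwDl// mulr_ge0.
  move: ts; rewrite ltr_pdivlMr// => /ltW; apply: le_trans.
  by rewrite mulrA mulrDr mulr1 [leLHS]mulrC lerDr.
have /choice[F hF] (i : 'I_m) : exists F : R -> R, F 0 = 0 /\
    forall t : R, 0 <= t -> is_derive t 1 F (H i (u t)).
  by have [F F0 dF] := continuous_primitive (@cH i); exists F.
pose w t : 'rV[R]_m := \row_i (a ord0 i + F i (clamp 0 T t)).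
have dw t : t \in `[0, T] -> forall i,
    has_derivative_in `[0, T]%classic (fun s => w s ord0 i) t (H i (u t)).
  move=> tT i; apply: (@is_derive_has_derivative_in _ _ _
    (fun s => a ord0 i + F i s)) => //.
    by move=> s sT; rewrite /w mxE clamp_id.
  have dF : is_derive t 1 (F i) (H i (u t)).
    by apply: (hF i).2; move: tT; rewrite in_itv/= => /andP[].
  by rewrite -[H i (u t)]add0r; exact: is_deriveD.
have pw : picard_image H a T u w.
  split=> [|i].
    by apply/rowP => i; rewrite /w mxE clamp_id// (hF i).1 addr0.
  split; first by apply: has_derivative_in_within_continuous => t tT; exact: dw.
  by move=> t tT; apply: dw; apply: subset_itv_oo_cc tT.
have wc t : w t = w (clamp 0 T t).
  by rewrite /w (@clamp_id _ _ _ (clamp 0 T t)) ?clamp_itv.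
exists w; split => //; split => // s t; apply/row_norm_le => [|i].
  by rewrite mulr_ge0.
rewrite rowB wc (wc t); apply: le_trans (picard_image_lipschitz i pw _ _) _.
- exact: clamp_itv.
- exact: clamp_itv.
- by rewrite ler_wpM2l// clamp_dist.
Qed.

(** The iterates started at the constant path [a] converge geometrically, and the limit equals its
    own image. The second conjunct adds the one-sided derivatives at the end points. *)
Lemma picard_fixpoint_exists : exists u,
  picard_image H a T u u /\
  forall t, t \in `[0, T] -> forall i,
    has_derivative_in `[0, T]%classic (fun s => u s ord0 i) t (H i (u t)).
Proof.
(* Choice needs a total map, so a path that is not [clamped_lipschitz] gets itself as a dummy
   value. *)
have /choice[Phi hPhi] (u : R -> 'rV[R]_m) : exists w, clamped_lipschitz u ->
    [/\ clamped_lipschitz w, picard_image H a T u w &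
      forall t, t \in `[0, T] -> forall i,
        has_derivative_in `[0, T]%classic (fun s => w s ord0 i) t (H i (u t))].
  have [cu|ncu] := pselect (clamped_lipschitz u); last by exists u.
  by have [w hw] := picard_image_exists cu; exists w.
pose x n := iter n Phi (fun=> a).
have cx n : clamped_lipschitz (x n).
  elim: n => [|n IH]; last by have [] := hPhi _ IH.
  by split => // s t; rewrite subrr normr0 mulr_ge0.
have px n : picard_image H a T (x n) (x n.+1) by have [] := hPhi _ (cx n).
(* The first increment is at most [c * T] because the speed is at most [c]; each later one is halved
   by the contraction. *)
have incr n t : t \in `[0, T] -> `|x n.+1 t - x n t| <= c * T / 2 ^+ n.
  elim: n t => [|n IH] t tT.
    rewrite expr0 divr1; apply/row_norm_le => [|i]; first exact: mulr_ge0.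
    have := picard_image_lipschitz i (px 0%N) T0 tT.
    rewrite (px 0%N).1 subr0 rowB => /le_trans; apply.
    move: tT; rewrite in_itv/= => /andP[t0 tT].
    by rewrite ger0_norm// ler_wpM2l.
  rewrite exprSr invfM mulrA.
  exact: picard_image_contraction (px n.+1) (px n) IH _ tT.
have /choice[u hu] (t : R) : exists l, forall n,
    `|x n t - l| <= 2 * (c * T) / 2 ^+ n.
  apply: row_geometric_increments_cvg => n.
  by rewrite (cx n).2 (cx n.+1).2 incr// clamp_itv.
(* Uniqueness of limits, in the form used twice below: to see that [u] is frozen outside the segment
   and that [u] is its own image. *)
have geo_lim (y : R -> 'rV[R]_m) t : (forall n, `|x n t - y t| <= 2 * (c * T) / 2 ^+ n) ->
    y t = u t.
  move=> hy; apply/eqP; rewrite -subr_eq0 -normr_le0.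
  apply: (@le_geometric_le0 _ _ (2 * (2 * (c * T)))) => n.
  rewrite -(subrK (x n t) (y t)) -addrA (le_trans (ler_normD _ _))//.
  have := hu t n; have := hy n; rewrite distrC; lra.
have cu : clamped_lipschitz u.
  split => [s t|t].
    rewrite -subr_le0; apply: (@le_geometric_le0 _ _ (2 * (2 * (c * T)))) => n.
    have := (cx n).1 s t; have := hu s n; have := hu t n.
    have := ler_distD (x n s) (u s) (u t); have := ler_distD (x n t) (x n s) (u t).
    rewrite (distrC (u s) (x n s)); lra.
  by apply/esym; apply: (geo_lim (fun t => u (clamp 0 T t))) => n; rewrite (cx n).2.
have [w [cw pw dw]] := picard_image_exists cu.
(* The distance from [x n] to [w] is at most the increment to [x n.+1] plus half the distance from
   [x n] to [u]: two terms [c * T / 2 ^+ n], exactly the rate that [geo_lim] requires. *)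
have wu : w = u.
  apply/funext => t; apply: geo_lim => n; rewrite (cx n).2 cw.2.
  move: (clamp 0 T t) (clamp_itv t T_ge0) => {}t tT.
  have := picard_image_contraction (px n) pw (fun t _ => hu t n) tT.
  have := ler_distD (x n.+1 t) (x n t) (w t); have := incr n t tT.
  rewrite (distrC (x n.+1 t) (x n t)); lra.
by rewrite wu in pw dw; exists u.
Qed.

End Picard.

(** * Sign preservation and confinement by first and last times *)

(** Provides the last or first time at which a continuous function is nonnegative, as an extremum of
    the identity on this set. *)
Lemma compact_within_ge0 (R : realType) (a b : R) (w : R -> R) :
  {within `[a, b], continuous w} ->
  compact [set t | t \in `[a, b] /\ 0 <= w t].
Proof.
move=> /subspace_continuousP cw.
apply: (subclosed_compact _ (@segment_compact _ a b)) => [t ct|t []//].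
have tab : t \in `[a, b].
  by apply: (@itv_closed _ _ a b t); apply: closure_subset ct => s [].
split => //; rewrite leNgt; apply/negP => wt.
have hn : \forall s \near within `[a, b] (nbhs t), w s < 0.
  exact: cvgr_lt (cw t tab) _ wt.
have [s [[sab ws] hs]] := ct _ hn.
by have := hs sab; rewrite ltNge ws.
Qed.

(** If [w t < 0], take the last [s] before [t] with [0 <= w s]. Between them [w] is negative, so its
    derivative is nonnegative there and the mean value theorem gives [w s <= w t], a
    contradiction. *)
Lemma ge0_on_segment (R : realType) (T : R) (w dw : R -> R) :
  {within `[0, T], continuous w} ->
  (forall x, x \in `]0, T[ -> has_derivative_in `[0, T] w x (dw x)) ->
  0 <= w 0 ->
  (forall x, x \in `]0, T[ -> w x < 0 -> 0 <= dw x) ->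
  forall t, t \in `[0, T] -> 0 <= w t.
Proof.
move=> cw hw w0 dw_ge0 t; rewrite in_itv/= => /andP[t0 tT].
rewrite leNgt; apply/negP => wt.
have ctw : {within `[0, t], continuous w}.
  by apply: continuous_subspaceW cw; exact: subset_itvl.
have [||s] := compact_EVT_max _ (compact_within_ge0 ctw) (f := id).
- by exists 0; split => //; rewrite in_itv/= lexx.
- by apply: continuous_subspaceT => x; exact: cvg_id.
rewrite inE => -[]; rewrite in_itv/= => /andP[s0 st] ws smax.
have {}st : s < t by rewrite lt_neqAle st andbT; apply: contraTneq wt => <-; rewrite -leNgt.
have [x] := segment_MVT cw hw s0 st tT.
rewrite in_itv/= => /andP[sx xt] E.
have wx : w x < 0.
  rewrite ltNge; apply/negP => wx; move: (sx); rewrite ltNge => /negP; apply.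
  apply: smax; rewrite inE; split => //; rewrite in_itv/=.
  by apply/andP; split; lra.
have : 0 <= dw x * (t - s).
  by rewrite mulr_ge0 ?dw_ge0 ?in_itv/=//; [apply/andP; split|]; lra.
by rewrite -E; lra.
Qed.

Lemma within_continuous_coord (R : realType) (m : nat) (A : set R)
    (u : R -> 'rV[R]_m) (i : 'I_m) :
  {within A, continuous u} -> {within A, continuous (fun s => u s ord0 i)}.
Proof.
move=> cu x; apply: (@continuous_comp _ _ _ _ (fun N : 'rV[R]_m => N ord0 i));
  [exact: cu|exact/differentiable_continuous/differentiable_coord].
Qed.

(** The speed bound is available only inside the ball, so consider the first time [s] with
    displacement at least [r]: up to then the bound holds, and the displacement at [s] is at most
    [c * s <= c * T < r]. *)
Lemma no_exit (R : realType) (m : nat) (T c r : R) (v dv : R -> 'rV[R]_m) :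
  {within `[0, T], continuous v} -> 0 <= c -> c * T < r ->
  (forall x, x \in `]0, T[ -> forall i,
    has_derivative_in `[0, T]%classic (fun s => v s ord0 i) x (dv x ord0 i)) ->
  (forall x, x \in `]0, T[ -> `|v x - v 0| < r ->
    forall i, `|dv x ord0 i| <= c) ->
  forall t, t \in `[0, T] -> `|v t - v 0| < r.
Proof.
move=> cv c0 cTr hv dvc t tT; rewrite ltNge; apply/negP => rt.
have T0 : 0 <= T by move: tT; rewrite in_itv/= => /andP[]; exact: le_trans.
have r0 : 0 < r by apply: le_lt_trans cTr; rewrite mulr_ge0.
have cvr : {within `[0, T], continuous (fun s => `|v s - v 0| - r)}.
  move=> x; apply: cvgB; last exact: cvg_cst.
  by apply: cvg_norm; apply: cvgB; [exact: cv|exact: cvg_cst].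
have [||s] := compact_EVT_min _ (compact_within_ge0 cvr) (f := id).
- by exists t; split => //; rewrite subr_ge0.
- by apply: continuous_subspaceT => x; exact: cvg_id.
rewrite inE => -[]; rewrite in_itv/= => /andP[s0 sT]; rewrite subr_ge0 => rs smin.
have {}s0 : 0 < s.
  rewrite lt_neqAle s0 andbT; apply: contraTneq rs => <-.
  by rewrite subrr normr0 -ltNge.
move: rs; rewrite leNgt => /negP; apply.
apply: le_lt_trans cTr; apply/row_norm_le => [|i]; first by rewrite mulr_ge0.
have cvi : {within `[0, T], continuous (fun s => v s ord0 i)}.
  exact: within_continuous_coord.
have [x] := segment_MVT cvi (fun x xT => hv x xT i) (lexx 0) s0 sT.
rewrite in_itv/= => /andP[x0 xs]; rewrite subr0 rowB => ->.
have xT : x \in `]0, T[ by rewrite in_itv/= x0 (lt_le_trans xs sT).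
rewrite normrM (ger0_norm (ltW s0)); apply: ler_pM => //; first exact: ltW.
apply: dvc => //.
rewrite ltNge; apply/negP => rx; move: (xs); rewrite ltNge => /negP; apply.
apply: smin; rewrite inE; split; last by rewrite subr_ge0.
by move: xT; rewrite !in_itv/= => /andP[/ltW -> /ltW ->].
Qed.

(** * Local bounds for the right-hand side of the system *)

(* [locally _] quantifies over pairs of points of A; only its instance at the
   diagonal pair (a, a) matters. *)
Lemma locally_lipschitz_ball (R : realType) (m : nat) (f : 'rV[R]_m -> R)
    (A : set 'rV[R]_m) (a : 'rV[R]_m) :
  [locally [lipschitz f x | x in A]] -> A a ->
  exists2 c, 1 <= c & forall x y, A x -> A y ->
    `|x - a| <= c^-1 -> `|y - a| <= c^-1 -> `|f x - f y| <= c * `|x - y|.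
Proof.
move=> hf Aa.
have [M M0] := pinfty_ex_gt0 (hf (a, a) (conj Aa Aa)).
rewrite /dominated_by /within/= => /nbhs_ballP[d /= d0 hd].
(* [M] is a Lipschitz constant on the ball of radius [d]; the term [2 / d] makes the inverse smaller
   than [d], and the 1 gives the lower bound. *)
exists (1 + M + 2 / d); first by rewrite -addrA lerDl addr_ge0 ?divr_ge0// ltW.
move=> x y Ax Ay.
have cd : (1 + M + 2 / d)^-1 < d.
  have dV : 0 < d^-1 by rewrite invr_gt0.
  by rewrite -[ltRHS]invrK ltf_pV2 ?posrE//; lra.
move=> xa ya; apply: (@le_trans _ _ (M * `|x - y|)).
  apply: (hd (x, y)) => //; split; rewrite /= -ball_normE /= distrC.
    exact: le_lt_trans cd.
  exact: le_lt_trans cd.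
by rewrite ler_wpM2r//; have : 0 < 2 / d by [rewrite divr_gt0]; lra.
Qed.

(** Monotonicity lets the maximum of the individual constants serve every index; starting the
    maximum at 1 also covers [m = 0]. *)
Lemma finite_upper_bound (R : realType) (m : nat) (P : 'I_m -> R -> Prop) :
  (forall i c d, c <= d -> P i c -> P i d) -> (forall i, exists c, P i c) ->
  exists2 c, 1 <= c & forall i, P i c.
Proof.
move=> mono /choice[c hc]; exists (\big[Num.max/1]_i c i).
  by apply/bigmax_geP; left.
by move=> i; apply: mono (hc i); exact: le_bigmax.
Qed.

Definition rate (R : realType) (m : nat) (f g : 'I_m -> 'rV[R]_m -> R)
    (i : 'I_m) (x : 'rV[R]_m) : R := - f i x * x ord0 i + g i x.

(* The same c serves as bound and as inverse radius, so that increasing it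
   weakens the claim and the maximum over i can be taken. *)
Lemma rate_local_bound (R : realType) (m : nat) (f g : 'I_m -> 'rV[R]_m -> R)
    (a : 'rV[R]_m) (A : set 'rV[R]_m) :
  (forall i, [locally [lipschitz f i x | x in A]]) ->
  (forall i, [locally [lipschitz g i x | x in A]]) ->
  A a ->
  exists2 c, 1 <= c & forall i x y, A x -> A y ->
    `|x - a| <= c^-1 -> `|y - a| <= c^-1 ->
    `|rate f g i x - rate f g i y| <= c * `|x - y| /\ `|rate f g i x| <= c.
Proof.
move=> f_lip g_lip Aa.
pose P i c := 1 <= c /\ forall x y, A x -> A y ->
  `|x - a| <= c^-1 -> `|y - a| <= c^-1 ->
  `|rate f g i x - rate f g i y| <= c * `|x - y| /\ `|rate f g i x| <= c.
suff /finite_upper_bound[|c c1 hc] : forall i, exists c, P i c.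
- move=> i c d cd [c1 hc]; split => [|x y Ax Ay xa ya]; first exact: le_trans cd.
  have c0 : 0 < c by rewrite (lt_le_trans _ c1).
  have dc : d^-1 <= c^-1 by rewrite lef_pV2 ?posrE ?(lt_le_trans c0 cd).
  have [] := hc x y Ax Ay (le_trans xa dc) (le_trans ya dc).
  move=> h1 h2; split; last exact: le_trans cd.
  by apply: (le_trans h1); rewrite ler_wpM2r.
- by exists c => // i; exact: (hc i).2.
move=> i.
have [p p1 hp] := locally_lipschitz_ball (f_lip i) Aa.
have [q q1 hq] := locally_lipschitz_ball (g_lip i) Aa.
(* These will bound [f i], the coordinates and [g i] on the ball of radius [c^-1], which is at most
   1. *)
pose F := `|f i a| + 1; pose N := `|a| + 1; pose K := `|g i a| + 1.
have F0 : 0 <= F by rewrite addr_ge0.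
have N0 : 0 <= N by rewrite addr_ge0.
have K0 : 0 <= K by rewrite addr_ge0.
have FN0 : 0 <= F * N by rewrite mulr_ge0.
have Np0 : 0 <= N * p by rewrite mulr_ge0//; lra.
(* The terms [F + N * p + q] form the Lipschitz constant of the rate and [F * N + K] its bound; [p]
   and [q] also make the ball of radius [c^-1] fit into those where [f i] and [g i] are
   Lipschitz. *)
pose c := p + q + F + N * p + F * N + K.
have c1 : 1 <= c by rewrite /c; lra.
exists c; split => // x y Ax Ay xa ya.
have pc : c^-1 <= p^-1 by rewrite lef_pV2 ?posrE /c; lra.
have qc : c^-1 <= q^-1 by rewrite lef_pV2 ?posrE /c; lra.
have cV1 : c^-1 <= 1 by rewrite invf_le1//; lra.
(* A Lipschitz constant [k] on a ball of radius [k^-1] allows a deviation of at most 1 from the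
   value at the centre. *)
have growth (h : 'rV[R]_m -> R) k : 1 <= k -> `|x - a| <= k^-1 ->
    `|h x - h a| <= k * `|x - a| -> `|h x| <= `|h a| + 1.
  move=> k1 xk hx; rewrite -(subrK (h a) (h x)) addrC (le_trans (ler_normD _ _))//.
  rewrite lerD2l (le_trans hx)// mulrC -ler_pdivlMr ?div1r//; lra.
have a0 k : 1 <= k -> `|a - a| <= k^-1 :> R.
  by move=> k1; rewrite subrr normr0 invr_ge0; lra.
have fx : `|f i x| <= F.
  apply: (growth _ p) => //; first exact: le_trans pc.
  by apply: hp => //; [exact: le_trans pc|exact: a0].
have gx : `|g i x| <= K.
  apply: (growth _ q) => //; first exact: le_trans qc.
  by apply: hq => //; [exact: le_trans qc|exact: a0].
have coordN z : `|z - a| <= c^-1 -> `|z ord0 i| <= N.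
  move=> za; apply: (le_trans (row_coord_le _ _)).
  rewrite -(subrK a z) addrC (le_trans (ler_normD _ _))// lerD2l.
  exact: le_trans cV1.
have fxy := hp x y Ax Ay (le_trans xa pc) (le_trans ya pc).
have gxy := hq x y Ax Ay (le_trans xa qc) (le_trans ya qc).
split; rewrite /rate.
  have -> : - f i x * x ord0 i + g i x - (- f i y * y ord0 i + g i y) =
      - (f i x * (x - y) ord0 i) - y ord0 i * (f i x - f i y) + (g i x - g i y).
    by rewrite rowB; ring.
  apply: (le_trans (ler_normD _ _)); apply: (le_trans (lerD (ler_normB _ _) gxy)).
  rewrite normrN !normrM.
  have h1 : `|f i x| * `|(x - y) ord0 i| <= F * `|x - y|.
    by apply: ler_pM => //; exact: row_coord_le.
  have h2 : `|y ord0 i| * `|f i x - f i y| <= N * (p * `|x - y|).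
    by apply: ler_pM => //; exact: coordN.
  have : 0 <= (p + F * N + K) * `|x - y| by rewrite mulr_ge0//; lra.
  rewrite /c; lra.
apply: (le_trans (ler_normD _ _)); rewrite normrM normrN.
have : `|f i x| * `|x ord0 i| <= F * N by apply: ler_pM => //; exact: coordN.
rewrite /c; lra.
Qed.

(** On the face [x_i = 0] the decay term vanishes, so the field does not point out of the
    orthant. *)
Lemma rate_ge0 (R : realType) (m : nat) (f g : 'I_m -> 'rV[R]_m -> R)
    (i : 'I_m) (x : 'rV[R]_m) :
  (forall y, orthant y -> 0 <= g i y) -> orthant x -> x ord0 i = 0 ->
  0 <= rate f g i x.
Proof. by move=> g0 xo x0; rewrite /rate x0 mulr0 add0r g0. Qed.

(** * Projection onto a box inside the orthant *)

(** In the maximum norm a closed ball is a cube, so for [a] in the orthant its intersection with the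
    orthant is a box and the projection acts on each coordinate separately. *)
Definition box_proj (R : realType) (m : nat) (a : 'rV[R]_m) (r : R)
    (x : 'rV[R]_m) : 'rV[R]_m :=
  \row_i clamp (Num.max 0 (a ord0 i - r)) (a ord0 i + r) (x ord0 i).

Section BoxProj.
Variables (R : realType) (m : nat) (a : 'rV[R]_m) (r : R).
Hypothesis a_ge0 : orthant a.
Hypothesis r_ge0 : 0 <= r.

Let box_le i : Num.max 0 (a ord0 i - r) <= a ord0 i + r.
Proof. by rewrite ge_max addr_ge0//=; have := r_ge0; lra. Qed.

Lemma box_proj_orthant x : orthant (box_proj a r x).
Proof.
move=> i; rewrite mxE; have := clamp_itv (x ord0 i) (box_le i).
by rewrite in_itv/= ge_max => /andP[/andP[]].
Qed.

Lemma box_proj_ball x : `|box_proj a r x - a| <= r.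
Proof.
apply/row_norm_le => // i; rewrite rowB mxE.
have := clamp_itv (x ord0 i) (box_le i).
rewrite in_itv/= ge_max => /andP[/andP[_ h1] h2].
by rewrite ler_norml; apply/andP; split; lra.
Qed.

Lemma box_proj_lipschitz x y : `|box_proj a r x - box_proj a r y| <= `|x - y|.
Proof.
apply/row_norm_le => // i; rewrite rowB !mxE.
by apply: (le_trans (clamp_dist _ _ _ _)); rewrite -rowB row_coord_le.
Qed.

Lemma box_proj_id x : orthant x -> `|x - a| <= r -> box_proj a r x = x.
Proof.
move=> xo /(row_norm_le _ r_ge0) xa; apply/rowP => i; rewrite mxE clamp_id//.
have := xa i; rewrite rowB ler_norml => /andP[h1 h2].
by rewrite in_itv/= ge_max xo/=; apply/andP; split; lra.
Qed.

Lemma box_proj_neg x i : `|x - a| <= r -> x ord0 i < 0 ->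
  box_proj a r x ord0 i = 0.
Proof.
move=> /(row_norm_le _ r_ge0)/(_ i); rewrite rowB ler_norml => /andP[h1 h2] xi.
rewrite mxE /clamp (max_l (y := a ord0 i - r)); last by lra.
by rewrite max_l// ge_min ltW.
Qed.

End BoxProj.

(** * Existence, nonnegativity and uniqueness for the original system *)

Lemma C1_on_segment_continuous (R : realType) (V : normedModType R) (a b : R)
    (u : R -> V) :
  C1_on_segment a b u -> {within `[a, b], continuous u}.
Proof. by move=> [du _ hu]; exact: has_derivative_in_within_continuous hu. Qed.

Theorem theorem1 (R : realType) (m : nat)
    (f g : 'I_m -> 'rV[R]_m -> R) (a : 'rV[R]_m)
    (f_ge0 : forall i x, orthant x -> 0 <= f i x)
    (g_ge0 : forall i x, orthant x -> 0 <= g i x)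
    (f_lip : forall i, [locally [lipschitz f i x | x in @orthant R m]])
    (g_lip : forall i, [locally [lipschitz g i x | x in @orthant R m]])
    (a_ge0 : forall i, 0 <= a ord0 i) :
  exists T : R, 0 < T /\
    exists u : R -> 'rV[R]_m,
      nonneg_solution f g a T u /\
      forall v : R -> 'rV[R]_m, nonneg_solution f g a T v ->
        forall t, t \in `[0, T] -> v t = u t.
Proof.
have [c c1 hc] := rate_local_bound f_lip g_lip a_ge0.
have c_gt0 : 0 < c by rewrite (lt_le_trans _ c1).
have c_ge0 := ltW c_gt0.
pose r := c^-1; have r_gt0 : 0 < r by rewrite invr_gt0.
have r_ge0 := ltW r_gt0.
(* With this choice [c * T = r / 2]: at most 1/2 for the contraction since [r <= 1], and below [r]
   so that no path leaves the ball. *)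
pose T := (2 * c * c)^-1; have T_gt0 : 0 < T by rewrite invr_gt0 !mulr_gt0.
have T_ge0 := ltW T_gt0.
have cTE : c * T = r / 2 by rewrite /T /r; field; rewrite gt_eqF.
have r1 : r <= 1 by rewrite invf_le1.
have cT : c * T <= 2^-1 by rewrite cTE; lra.
have cTr : c * T < r by rewrite cTE; lra.
have T0 : 0 \in `[0, T] by rewrite in_itv/= lexx.
pose P := box_proj a r; pose H i x := rate f g i (P x).
have H_lip i x y : `|H i x - H i y| <= c * `|x - y|.
  apply: (@le_trans _ _ (c * `|P x - P y|)).
    by apply: (hc i _ _ _ _ _ _).1; rewrite ?box_proj_ball//; exact: box_proj_orthant.
  by rewrite ler_wpM2l// box_proj_lipschitz.
have H_bound i x : `|H i x| <= c.
  by apply: (hc i _ (P x) _ _ _ _).2; rewrite ?box_proj_ball//; exact: box_proj_orthant.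
have HE i x : orthant x -> `|x - a| <= r -> H i x = rate f g i x.
  by move=> xo xa; rewrite /H /P box_proj_id.
(* A given solution follows [rate], which is controlled only near [a], so confinement needs the
   first-exit argument. *)
have solution_ball v : nonneg_solution f g a T v ->
    forall t, t \in `[0, T] -> `|v t - a| < r.
  move=> [cv v_ge0 v0 dv]; rewrite -v0.
  apply: (@no_exit _ _ T c r v (fun t => \row_i rate f g i (v t))) => //.
  - exact: C1_on_segment_continuous cv.
  - by move=> x xT i; rewrite mxE; apply: dv; apply: subset_itv_oo_oc xT.
  - move=> x xT; rewrite v0 => /ltW xa i; rewrite mxE.
    have xo : orthant (v x) by move=> j; apply: v_ge0; exact: subset_itv_oo_cc xT.
    exact: (hc i _ (v x) xo xo xa xa).2.
have solution_picard v : nonneg_solution f g a T v -> picard_image H a T v v.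
  move=> hv; have [cv v_ge0 v0 dv] := hv; split => // i; split.
    exact/within_continuous_coord/C1_on_segment_continuous.
  move=> t tT; have tT' := subset_itv_oo_cc tT.
  rewrite HE; first by apply: dv; exact: subset_itv_oo_oc tT.
    by move=> j; exact: v_ge0.
  by rewrite ltW// solution_ball.
have [u [pu du]] := picard_fixpoint_exists a T_ge0 cT H_lip H_bound c_ge0.
(* The fixed point follows [H], whose bound is global, so the speed bound alone confines it. *)
have ua t : t \in `[0, T] -> `|u t - a| <= r.
  move=> tT; apply/row_norm_le => // i; rewrite rowB -{1}pu.1.
  apply: (le_trans (picard_image_lipschitz H_bound i pu T0 tT)).
  move: tT; rewrite in_itv/= subr0 => /andP[t0 tT]; rewrite ger0_norm//.
  by apply: le_trans (ltW cTr); rewrite ler_wpM2l.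
have u_ge0 t : t \in `[0, T] -> orthant (u t).
  move=> tT i; move: t tT.
  apply: (@ge0_on_segment _ _ _ (fun t => H i (u t))).
  - exact: (pu.2 i).1.
  - exact: (pu.2 i).2.
  - by rewrite pu.1.
  - move=> x /subset_itv_oo_cc xT ux; apply: rate_ge0; first exact: g_ge0.
      exact: box_proj_orthant.
    by apply: box_proj_neg => //; exact: ua.
have cu : C1_on_segment 0 T u.
  exists (fun t => \row_i H i (u t)).
    have /subspace_continuousP cu : {within `[0, T], continuous u}.
      apply: (@has_derivative_in_within_continuous _ _ _ _
        (fun t => \row_i H i (u t))) => t tT.
      by apply/has_derivative_in_row => i; rewrite mxE; exact: du.
    apply/subspace_continuousP => t tT; apply/cvgrPdist_le => e e0.
    have /cvgrPdist_le/(_ (e / c)) := cu t tT; rewrite divr_gt0// => /(_ isT).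
    apply: filterS => s; rewrite ler_pdivlMr// => hs.
    apply: le_trans hs; rewrite mulrC; apply/row_norm_le => [|i].
      by rewrite mulr_ge0.
    by rewrite rowB !mxE.
  by move=> t tT; apply/has_derivative_in_row => i; rewrite mxE; exact: du.
exists T; split => //; exists u; split.
  split => //; first exact: pu.1.
  move=> t /subset_itv_oc_cc tT i; have := du t tT i.
  by rewrite HE//; [exact: u_ge0|exact: ua].
(* Both paths stay within distance [r] of [a], which supplies the a priori bound [r + r]. *)
move=> v hv; apply: (@picard_fixpoint_unique _ _ H a T c _ _ _ _ v u (r + r)) => //.
  exact: solution_picard.
move=> t tT; apply: (le_trans (ler_distD a _ _)).
by rewrite lerD// ?(ltW (solution_ball _ hv _ tT))// distrC ua.
Qed.
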